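(* Let $p\in[1,\infty]$, let $(\alpha_n)_{n=1}^\infty$ be a decreasing sequence of positive real numbers with $\alpha_n\to0$, and let $A=\{\alpha_ne_n:n\in\mathbb{N}\}\subset\ell_p$, where $e_n$ is the sequence whose $n$-th entry is $1$ and whose other entries are $0$. Then $$\tau^*(A)\le d_B(A).$$
   Context: For $p=\infty$ the space $\ell_p$ is understood to be $c_0$, the space of real sequences converging to zero with the supremum norm. ''Decreasing'' means $\alpha_{n+1}\le\alpha_n$ (ties allowed). Box-counting dimension: $d_B(A)=\limsup_{\epsilon\to0}\frac{\log N(A,\epsilon)}{-\log\epsilon}$, where $N(A,\epsilon)$ is the minimum number of balls of radius $\epsilon$ with centres in $A$ required to cover $A$ (balls in $\ell_p$). For these sets it is known that $d_B(A)=\limsup_{n\to\infty}\frac{\log n}{-\log\alpha_n}$, so it is independent of $p$. Dual thickness exponent: for a subset $X$ of a real Banach space $\mathfrak{B}$ (here $X=A$, $\mathfrak{B}=\ell_p$) and $\epsilon,\theta>0$, let $d_\theta(X,\epsilon)$ be the minimum dimension of all those linear subspaces $U$ of the dual $\mathfrak{B}^*$ with the property that for every $x,y\in X$ with $\|x-y\|\ge\epsilon$ there exists $\phi\in U$ with $\|\phi\|=1$ and $|\phi(x-y)|\ge\epsilon^{1+\theta}$ (with $d_\theta(X,\epsilon)=\infty$ if no such finite-dimensional subspace exists). For $\theta>0$ put $\tau^*_\theta(X)=\limsup_{\epsilon\to0}\frac{\log d_\theta(X,\epsilon)}{-\log\epsilon}$, and set $\tau^*(X)=\lim_{\theta\to0}\tau^*_\theta(X)$.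 *)

(* Defs.v *)
From HB Require Import structures.
From mathcomp Require Import all_boot all_order all_algebra.
From mathcomp Require finmap ess_sup_inf.
From mathcomp Require Import all_classical all_reals all_analysis.

Set Implicit Arguments.
Unset Strict Implicit.
Unset Printing Implicit Defensive.
Import Order.TTheory GRing.Theory Num.Theory.
Import numFieldNormedType.Exports.
Local Open Scope classical_set_scope.
Local Open Scope ring_scope.

(* The spaces ell_p = L^p(nat, counting) for 1 <= p < +oo, and c_0 for p = +oo.
   In both cases the norm is the library's L^p norm for the counting measure. *)

Section ell.
Context {R : realType}.
Local Notation mu := (@counting nat R).
Implicit Types (p : \bar R) (u v : nat -> R).

Definition ell_mem p : {pred (nat -> R)} :=
  mem [set u | finite_norm mu p u /\ (p = +oo%E -> u @ \oo --> (0 : R))].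

(* The argument p1 : 1 <= p makes the canonical instances below available. *)
Record ell p (p1 : (1 <= p)%E) := Ell {
  ell_val :> nat -> R;
  ell_valP : ell_val \in ell_mem p
}.

Lemma Lfun_nat p u : finite_norm mu p u -> u \in Lfun mu p.
Proof. by move=> fu; apply/andP; split; apply/mem_set. Qed.

Lemma counting_ae (P : nat -> Prop) : (\forall x \ae mu, P x) -> forall x, P x.
Proof.
move=> [N [_ N0 PN]] x; apply: contrapT => nPx.
have Nx : N x by exact: PN.
have : (mu [set x] <= mu N)%E by apply: le_measure; rewrite ?inE// => _ ->.
by rewrite N0 /counting asboolT// fset_set1 finmap.cardfs1 lee_fin ler10.
Qed.

Lemma counting_gt0 : (0 < mu [set: nat])%E.
Proof.
by rewrite /counting asboolF//; exact: infinite_nat.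
Qed.

Lemma Lnorm_countingy (u : nat -> R) :
  'N[mu]_+oo[EFin \o u]%E = ereal_sup [set `|u n|%:E | n in [set: nat]].
Proof.
rewrite unlock counting_gt0; apply/eqP; rewrite eq_le; apply/andP; split.
  apply/ess_sup_inf.ess_supP/nearW => n /=; apply: ereal_sup_ubound => /=.
  by exists n.
apply: ge_ereal_sup => _ [n _ <-].
by have /counting_ae/(_ n) := ess_sup_inf.ess_sup_ge mu (abse \o (EFin \o u)).
Qed.

Section ell_p.
Variables (p : \bar R) (p1 : (1 <= p)%E).

Lemma ell_mem_submod_closed : submod_closed (ell_mem p).
Proof.
split.
  apply/mem_set; split; first exact: finite_norm_cst0.
  by move=> _; exact: cvg_cst.
move=> a u v /set_mem[fu cu] /set_mem[fv cv]; apply/mem_set; split.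
  have [sub0 sublin] := Lfun_submod_closed mu p1.
  have /andP[_ /set_mem//] := sublin a _ _ (Lfun_nat fu) (Lfun_nat fv).
move=> py; rewrite -[X in _ --> X]addr0 -[X in _ --> X + _](scaler0 _ a).
by apply: cvgD; [apply: cvgZr; exact: cu|exact: cv].
Qed.

HB.instance Definition _ := GRing.isSubmodClosed.Build _ _ (ell_mem p)
  ell_mem_submod_closed.

HB.instance Definition _ := [isSub of @ell p p1 for @ell_val p p1].
HB.instance Definition _ := [Choice of @ell p p1 by <:].
HB.instance Definition _ := [SubChoice_isSubLmodule of @ell p p1 by <:].

Definition ell_norm (x : ell p1) : R := fine 'N[mu]_p[EFin \o x]%E.

Lemma ell_norm_fine (x : ell p1) : (ell_norm x)%:E = 'N[mu]_p[EFin \o x]%E.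
Proof.
rewrite /ell_norm fineK// fin_numElt (lt_le_trans ltNy0) ?Lnorm_ge0//=.
by have /set_mem[] := ell_valP x.
Qed.

Let ler_ell_normD (x y : ell p1) : ell_norm (x + y) <= ell_norm x + ell_norm y.
Proof. by rewrite -lee_fin EFinD !ell_norm_fine; exact: eminkowski. Qed.

Let ell_normZ (a : R) (x : ell p1) : ell_norm (a *: x) = `|a| * ell_norm x.
Proof.
apply: EFin_inj; rewrite EFinM !ell_norm_fine.
have /set_mem[/Lfun_nat fx _] := ell_valP x.
exact: (LnormZ (Lfun_Sub p1 fx) a).
Qed.

Let ell_norm_eq0 (x : ell p1) : ell_norm x = 0 -> x = 0.
Proof.
move=> x0; apply/val_inj/funext => n.
have := ell_norm_fine x; rewrite x0 => /esym/Lnorm_eq0_eq0.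
move=> /(_ _ (lt_le_trans lte01 p1)) x0'.
have /counting_ae/(_ n) : (EFin \o x) = cst 0%E %[ae mu] by exact: x0'.
by move=> /(_ I)[].
Qed.

HB.instance Definition _ := @Lmodule_isNormed.Build R (ell p1)
  ell_norm ler_ell_normD ell_normZ ell_norm_eq0.

Definition unit_seq (n : nat) : nat -> R := fun k => (k == n)%:R.

Lemma unit_seq_mem n : unit_seq n \in ell_mem p.
Proof.
apply/mem_set; split; last first.
  move=> _; apply: cvg_near_cst => /=.
  by near=> k; rewrite /unit_seq gtn_eqF//; near: k; exists n.+1.
case: p p1 => [r r1|_|//]; rewrite /finite_norm; last first.
  rewrite Lnorm_countingy (@le_lt_trans _ _ 1%E) ?ltry//.
  apply: ge_ereal_sup => _ [k _ <-].
  by rewrite lee_fin /unit_seq; case: (k == n); rewrite ?normr1 ?normr0.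
have r0 : 0 < r by rewrite (lt_le_trans ltr01).
rewrite Lnorm_counting//; apply: poweR_lty.
rewrite (@nneseries_split _ _ 0 n.+1) ?add0n; last first.
  by move=> k _; rewrite poweR_ge0.
rewrite eseries0 ?adde0; last first.
  move=> k nk _; rewrite /= /unit_seq gtn_eqF// normr0 powR0//.
  by rewrite gt_eqF.
apply: lte_sum_pinfty => k _; exact: ltry.
Unshelve. all: by end_near. Qed.

Definition ell_e n : ell p1 := Ell p1 (unit_seq_mem n).

End ell_p.

Lemma ell_norm_fin (r : R) (r1 : (1 <= r%:E)%E) (x : ell r1) :
  (`|x|%:E = (\sum_(k <oo) `|x k|%:E `^ r) `^ r^-1)%E.
Proof.
rewrite [LHS](ell_norm_fine x) Lnorm_counting//.
by rewrite (lt_le_trans ltr01).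
Qed.

Lemma ell_norm_infty (y1 : (1 <= +oo :> \bar R)%E) (x : ell y1) :
  `|x|%:E = ereal_sup [set `|x n|%:E | n in [set: nat]].
Proof. by rewrite -Lnorm_countingy; exact: ell_norm_fine. Qed.

End ell.

Section dual.
Context {R : realType} {V : normedModType R}.
Implicit Types (f : V -> R) (U : set (V -> R)) (X : set V) (m : nat).

Definition dual : set (V -> R) := [set f | linear f /\ continuous f].

Definition dual_norm f : R := sup [set `|f x| | x in [set x : V | `|x| <= 1]].

(* U is an m-dimensional linear subspace of the dual: it has a basis e. *)
Definition dual_subspace U m :=
  exists e : 'I_m -> V -> R,
    [/\ forall i, dual (e i),
        forall c : 'I_m -> R, \sum_i c i *: e i = 0 -> forall i, c i = 0 &
        U = [set \sum_i c i *: e i | c in [set: 'I_m -> R]]].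

Definition norms_differences X (theta eps : R) U :=
  forall x y, X x -> X y -> eps <= `|x - y| ->
    exists2 f, U f & dual_norm f = 1 /\ eps `^ (1 + theta) <= `|f (x - y)|.

(* ereal_inf set0 = +oo: no finite-dimensional subspace has the property. *)
Definition dual_dim X (theta eps : R) : \bar R :=
  ereal_inf [set m%:R%:E | m in
    [set m | exists2 U, dual_subspace U m & norms_differences X theta eps U]].

Definition tau_dual_at X (theta : R) : \bar R :=
  limf_esup (fun eps => lne (dual_dim X theta eps) / (- ln eps)%:E)%E 0^'+.

Definition tau_dual X : \bar R := lim (tau_dual_at X theta @[theta --> 0^'+]).

Lemma le_dual_dim X (eps t1 t2 : R) : 0 < eps -> eps < 1 -> t1 <= t2 ->
  (dual_dim X t2 eps <= dual_dim X t1 eps)%E.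
Proof.
move=> e0 e1 t12; apply: ereal_inf_le_tmp => _ [m [U Um UX] <-].
exists m => //; exists U => // x y Xx Xy xy.
have [f Uf [f1 fxy]] := UX _ _ Xx Xy xy; exists f => //; split => //.
by apply: le_trans fxy; apply: ger_powR; rewrite ?e0 ?(ltW e1)// lerD2l.
Qed.

(* The limit defining tau_dual always exists. *)
Lemma is_cvg_tau_dual X : cvg (tau_dual_at X theta @[theta --> 0^'+]).
Proof.
apply: nonincreasing_at_right_is_cvge; apply: nearW => b t1 t2 _ _ t12.
apply: le_ereal_inf_tmp => _ [W W0 <-].
have I0 : (0 : R)^'+ [set` `]0, 1[].
  by near=> e; rewrite /= in_itv/=; apply/andP; split; near: e;
    [exact: nbhs_right_gt|exact: nbhs_right_lt].
apply: (@le_trans _ _ (ereal_sup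
  [set (lne (dual_dim X t2 e) / (- ln e)%:E)%E | e in W `&` [set` `]0, 1[]])).
  by apply: ereal_inf_lbound; exists (W `&` [set` `]0, 1[]) => //; exact: filterI.
apply: ge_ereal_sup => _ [e [We +] <-]; rewrite /= in_itv/= => /andP[e0 e1].
apply: (@le_trans _ _ (lne (dual_dim X t1 e) / (- ln e)%:E)%E); last first.
  by apply: ereal_sup_ubound; exists e.
have Nln_gt0 : 0 < - ln e by rewrite oppr_gt0 ln_lt0// e0 e1.
rewrite lee_pmul2r ?inver ?gt_eqF ?lte_fin ?invr_gt0//.
have d0 t : (0 <= dual_dim X t e)%E.
  by apply: le_ereal_inf_tmp => _ [m _ <-]; rewrite lee_fin.
by rewrite lee_lne ?in_itv/= ?d0 ?leey// le_dual_dim.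
Unshelve. all: by end_near. Qed.

(* The balls are open; closed balls give the same box_dim, as the two covering
   numbers bound each other after halving eps. Repeated centres are harmless
   for the minimum. *)
Definition cover_num X (eps : R) : \bar R :=
  ereal_inf [set m%:R%:E | m in [set m | exists c : 'I_m -> V,
    (forall i, X (c i)) /\ X `<=` \bigcup_i ball (c i) eps]].

Definition box_dim X : \bar R :=
  limf_esup (fun eps => lne (cover_num X eps) / (- ln eps)%:E)%E 0^'+.

End dual.

(* Main.v *)
(* Let m be the number of indices k with alpha_k >= eps/2. The first m coordinate
   functionals, all of norm 1, separate any two points of A at distance at least
   eps, so d_theta(A, eps) <= m as soon as eps^theta <= 1/2. Each of the first m
   points of A is at distance at least eps/2 from all the others, so it must be
   a centre of any cover by (open) eps/2-balls: m <= N(A, eps/2). *)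

Require Import Defs.
From mathcomp Require Import all_boot all_order all_algebra.
From mathcomp Require Import all_classical all_reals all_analysis.
From mathcomp Require Import lra.
Import Order.TTheory GRing.Theory Num.Theory.
Import numFieldNormedType.Exports.
Local Open Scope classical_set_scope.
Local Open Scope ring_scope.

Section coordinates.
Context {R : realType} {p : \bar R} (p1 : (1 <= p)%E).
Implicit Types x y : ell p1.

Lemma ell_linE (a : R) x y k : (a *: x + y) k = a * x k + y k.
Proof. by []. Qed.

Lemma ell_subE x y k : (x - y) k = x k - y k.
Proof. by []. Qed.

Lemma ell_scale_eE (a : R) n k : (a *: ell_e p1 n) k = a * (k == n)%:R.
Proof. by []. Qed.

(** For finite [p], one term of a nonnegative series is at most its sum. The bound makes coordinate
    functionals continuous with norm at most 1, and keeps points with different supports apart. *)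
Lemma coord_le_norm x k : `|x k| <= `|x|.
Proof.
rewrite -lee_fin; case: p p1 x => [r|y1 x|//]; last first.
  by rewrite ell_norm_infty; apply: ereal_sup_ubound; exists k.
move=> r1 x; have r0 : 0 < r by rewrite (lt_le_trans ltr01).
rewrite ell_norm_fin.
have xr : (`|x k|%:E `^ r <= \sum_(j <oo) `|x j|%:E `^ r)%E.
  rewrite (@nneseriesD1 _ _ k)// => [|j _]; last exact: poweR_ge0.
  by rewrite leeDl// nneseries_ge0// => j _ _; exact: poweR_ge0.
(* Writing the left side as the [r]-th root of its [r]-th power reduces the goal to [xr]. *)
rewrite -[leLHS](@poweRe1 R)// -[X in (_ `^ X)%E](@mulfV R r) ?gt_eqF// poweRrM.
apply: gt0_ler_poweR => //; first by rewrite invr_ge0 ltW.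
- by rewrite in_itv; apply/andP; split; [exact: poweR_ge0|exact: leey].
- by rewrite in_itv/= (le_trans (poweR_ge0 _ _) xr) leey.
Qed.

Lemma norm_ell_e_le n : `|ell_e p1 n| <= 1.
Proof.
rewrite -lee_fin; case: p p1 => [r|y1|//]; last first.
  rewrite ell_norm_infty; apply: ge_ereal_sup => _ [k _ <-].
  by rewrite lee_fin /= /unit_seq; case: (k == n); rewrite ?normr1 ?normr0.
move=> r1; have r0 : 0 < r by rewrite (lt_le_trans ltr01).
rewrite ell_norm_fin (@nneseriesD1 _ _ n)// => [|k _]; last exact: poweR_ge0.
rewrite eseries0 => [|k _ /= /negPf kn]; last first.
  by rewrite /unit_seq kn normr0 powR0// gt_eqF.
by rewrite adde0 /= /unit_seq eqxx normr1 !powR1.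
Qed.

Definition coord k : ell p1 -> R := fun x => x k.

Lemma coord_dual k : dual (coord k).
Proof.
split; first by move=> a x y; exact: ell_linE.
move=> x; apply/(@cvgrPdist_le _ _ _ (nbhs x)) => e e0.
have : \forall y \near nbhs x, `|x - y| <= e by apply: cvgr_dist_le.
by apply: filterS => y; apply: le_trans; exact: (coord_le_norm (x - y)).
Qed.

(** The supremum is attained at [ell_e p1 k]. *)
Lemma dual_norm_coord k : dual_norm (coord k) = 1.
Proof.
have ub1 : ubound [set `|coord k x| | x in [set x : ell p1 | `|x| <= 1]] 1.
  by move=> _ [x x1 <-]; exact: le_trans (coord_le_norm x k) x1.
have e1 : [set `|coord k x| | x in [set x : ell p1 | `|x| <= 1]] 1.
  exists (ell_e p1 k); first exact: norm_ell_e_le.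
  by rewrite /coord /= /unit_seq eqxx normr1.
apply/eqP; rewrite eq_le; apply/andP; split; first by apply: ge_sup => //; exists 1.
by apply: ub_le_sup => //; exists 1.
Qed.

Lemma dual_subspace_coord m :
  dual_subspace [set \sum_(i < m) c i *: coord i | c in [set: 'I_m -> R]] m.
Proof.
exists (fun i : 'I_m => coord i); split => // [i|c c0 i]; first exact: coord_dual.
(* Evaluation at [ell_e p1 i] leaves only the coefficient [c i]. *)
have := congr1 (fun f => f (ell_e p1 i)) c0.
rewrite fct_sumE (eq_bigr (fun j : 'I_m => c j * (val j == val i)%:R))//.
rewrite (bigD1 i)//= eqxx mulr1 big1 ?addr0// => j ji.
by rewrite -val_eqE in ji; rewrite (negPf ji) mulr0.
Qed.

End coordinates.

Section scaled_basis.
Context {R : realType} {p : \bar R} (p1 : (1 <= p)%E).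
Variable alpha : nat -> R.
Hypothesis alpha_gt0 : forall n, 0 < alpha n.
Hypothesis alpha_decr : forall n, alpha n.+1 <= alpha n.
Hypothesis alpha_cvg0 : alpha @ \oo --> (0 : R).

Let A : set (ell p1) := [set alpha n *: ell_e p1 n | n in [set: nat]].

Let alpha_mono m n : (m <= n)%N -> alpha n <= alpha m.
Proof. by move: m n; exact/nonincreasing_seqP. Qed.

(** Take the least [m] with [alpha m < d]; as [alpha] is decreasing, it counts the indices [k] with
    [d <= alpha k]. *)
Lemma exists_level d : 0 < d ->
  exists2 m, alpha m < d & forall k, (k < m)%N -> d <= alpha k.
Proof.
move=> d0.
have ex : exists n, alpha n < d.
  have [n _ /(_ n (leqnn n))] : \forall n \near \oo, `|alpha n| < d.
    by apply: cvgr_norm_lt alpha_cvg0 _ _; rewrite normr0.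
  by rewrite /= gtr0_norm//; exists n.
have [m am mmin] := ex_minnP ex; exists m => // k km; rewrite leNgt.
by apply/negP => /mmin; rewrite leqNgt km.
Qed.

Lemma leq_cover d m n (c : 'I_n -> ell p1) :
  (forall k, (k < m)%N -> d <= alpha k) ->
  (forall i, A (c i)) -> A `<=` \bigcup_i ball (c i) d -> (m <= n)%N.
Proof.
move=> dm Ac Acov.
have /choice[g cg] (k : 'I_m) : exists i, c i = alpha k *: ell_e p1 k.
  have [//|i _] := Acov (alpha k *: ell_e p1 k); first by exists (val k).
  rewrite -ball_normE /= => ikd; exists i.
  have [j _ cij] := Ac i; rewrite -cij.
  have [->//|jk] := eqVneq j (val k).
  (* A centre of index [j] other than [k] vanishes at coordinate [k], so its distance to the [k]-th
     point is at least [alpha k], hence at least [d]. *)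
  have := le_lt_trans (coord_le_norm _ _ k) ikd.
  rewrite ell_subE -cij !ell_scale_eE eqxx eq_sym (negPf jk) mulr0 mulr1 sub0r.
  by rewrite normrN gtr0_norm// ltNge dm.
(* One centre cannot equal two of the points: at coordinate [k] the [k]-th is positive and the
   others are zero. *)
have : injective g.
  move=> k l gkl; have := cg k; rewrite gkl cg => /(congr1 (fun x : ell p1 => x k)).
  rewrite !ell_scale_eE eqxx mulr1; have [/val_inj//|_] := eqVneq (val k) (val l).
  by rewrite mulr0 => /eqP; rewrite lt_eqF.
by move=> /leq_card; rewrite !card_ord.
Qed.

(* Of two points at distance at least [eps], the one of smaller index has norm
   at least [eps / 2], and its coordinate functional separates them. *)
Lemma norms_differences_coord theta eps m : 0 < eps -> eps `^ theta <= 2^-1 ->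
  alpha m < eps / 2 ->
  norms_differences A theta eps
    [set \sum_(i < m) c i *: coord p1 i | c in [set: 'I_m -> R]].
Proof.
move=> e0 et am.
have sep i j : (i < j)%N ->
    eps <= `|alpha i *: ell_e p1 i - alpha j *: ell_e p1 j| ->
    (i < m)%N /\ eps `^ (1 + theta) <=
      `|(alpha i *: ell_e p1 i - alpha j *: ell_e p1 j) i|.
  move=> ij le.
  have nrm k : `|alpha k *: ell_e p1 k| <= alpha k.
    by rewrite normrZ gtr0_norm// ler_piMr ?norm_ell_e_le// ltW.
  (* Since [i < j], [eps <= alpha i + alpha j <= 2 * alpha i]. *)
  have ei : eps / 2 <= alpha i.
    rewrite ler_pdivrMr// mulr_natr mulr2n (le_trans le)//.
    rewrite (le_trans (ler_normB _ _))// lerD// (le_trans (nrm _))//.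
    by rewrite alpha_mono// ltnW.
  split.
    by rewrite ltnNge; apply/negP => /alpha_mono; rewrite leNgt (lt_le_trans am).
  rewrite ell_subE !ell_scale_eE eqxx ltn_eqF// mulr0 mulr1 subr0 gtr0_norm//.
  (* Splitting a factor [eps] off the power leaves exactly the hypothesis on [theta]. *)
  apply: le_trans ei; rewrite powRD; last by rewrite (gt_eqF e0) implybT.
  by rewrite powRr1 ?(ltW e0)// ler_pM2l.
have mem i : (i < m)%N ->
    [set \sum_(i < m) c i *: coord p1 i | c in [set: 'I_m -> R]] (coord p1 i).
  move=> im; exists (fun k => (k == Ordinal im)%:R) => //.
  rewrite (bigD1 (Ordinal im))//= eqxx scale1r big1 ?addr0// => k /negPf->.
  by rewrite scale0r.
move=> _ _ [i _ <-] [j _ <-].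
case: (ltngtP i j) => [ij|ji|->].
- move=> /(sep _ _ ij)[im le]; exists (coord p1 i); first exact: mem.
  by rewrite dual_norm_coord.
- rewrite distrC => /(sep _ _ ji)[jm le]; exists (coord p1 j); first exact: mem.
  by rewrite dual_norm_coord; split => //; rewrite -opprB /coord normrN.
- by rewrite subrr normr0 leNgt e0.
Qed.

(** A single [m], taken at level [eps / 2], bounds the dual dimension from above and the size of
    every cover from below. *)
Lemma dual_dim_le_cover_num theta eps : 0 < eps -> eps `^ theta <= 2^-1 ->
  (dual_dim A theta eps <= cover_num A (eps / 2))%E.
Proof.
move=> e0 et; apply: le_ereal_inf_tmp => _ [n [c [Ac Acov]] <-].
have [m am dm] := exists_level _ (divr_gt0 e0 (ltr0n _ 2)).
apply: (@le_trans _ _ m%:R%:E); last first.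
  by rewrite lee_fin ler_nat; exact: leq_cover dm Ac Acov.
apply: ereal_inf_lbound; exists m => //.
exists [set \sum_(i < m) c i *: coord p1 i | c in [set: 'I_m -> R]].
  exact: dual_subspace_coord.
exact: norms_differences_coord.
Qed.

(* Passing from [eps] to [eps / 2] only adds [ln 2] to [- ln eps], which the
   gap between [b'] and [b] absorbs as [eps] tends to [0]. *)
Lemma tau_dual_at_le (theta b' b : R) : 0 < theta ->
  (box_dim A < b'%:E)%E -> b' < b -> (tau_dual_at A theta <= b%:E)%E.
Proof.
move=> t0 /ereal_inf_lt[_ [W [d /= d0 dW] <-] Wb'] b'b.
(* The limsup is an infimum of suprema, so one set of small [e] suffices. Its condition on [ln e]
   amounts to [b' * (ln 2 - ln e) <= b * (- ln e)]. *)
apply: (@le_trans _ _ (ereal_sup [set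
    (lne (dual_dim A theta e) / (- ln e)%:E)%E | e in
    [set e | [/\ W (e / 2), 0 < e, e < 1, e `^ theta <= 2^-1 &
              ln e <= - (b' / (b - b') * ln 2)]]])).
  apply: ereal_inf_lbound; eexists; last by [].
  near=> e; have e0 : 0 < e by near: e; exact: nbhs_right_gt.
  split => //.
  - apply: dW; last by rewrite divr_gt0.
    rewrite /= sub0r normrN gtr0_norm ?divr_gt0// ltr_pdivrMr//.
    apply: (@lt_trans _ _ d); last by rewrite ltr_pMr// ltr1n.
    by near: e; exact: nbhs_right_lt.
  - by near: e; apply: cvgr_le (powR_cvg0 t0) _ _; rewrite invr_gt0.
  - by near: e; exact: cvgrNy_le (@lnNy R) _.
apply: ge_ereal_sup => _ [e [We e0 e1 et le] <-].
have Nlne : 0 < - ln e by rewrite oppr_gt0 ln_lt0// e0.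
have e2 : e / 2 < 1 by rewrite ltr_pdivrMr// mul1r (lt_trans e1)// ltr1n.
have Nlne2 : 0 < - ln (e / 2) by rewrite oppr_gt0 ln_lt0// divr_gt0.
have dc := dual_dim_le_cover_num theta e e0 et.
have dd0 : (0 <= dual_dim A theta e)%E.
  by apply: le_ereal_inf_tmp => _ [m _ <-]; rewrite lee_fin.
rewrite inver gt_eqF// lee_pdivrMr//.
apply: (@le_trans _ _ (lne (cover_num A (e / 2)))).
  by rewrite lee_lne// in_itv/= leey ?dd0 ?(le_trans dd0 dc).
have : (lne (cover_num A (e / 2)) / (- ln (e / 2))%:E <= b'%:E)%E.
  by apply: le_trans (ltW Wb'); apply: ereal_sup_ubound; exists (e / 2).
rewrite inver gt_eqF// lee_pdivrMr// => /le_trans; apply.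
rewrite -!EFinM lee_fin lnM ?posrE ?invr_gt0// lnV ?posrE//.
move: le; rewrite lerNr mulrAC ler_pdivrMr ?subr_gt0//; lra.
Unshelve. all: by end_near. Qed.

Lemma tau_dual_at_le_box_dim theta : 0 < theta ->
  (tau_dual_at A theta <= box_dim A)%E.
Proof.
move=> t0; have taule b' b := @tau_dual_at_le theta b' b t0.
case: (box_dim A) taule => [r| |] taule; last 2 first.
- exact: leey.
(* If [box_dim A] is [-oo], every real [b] is an upper bound, so a value [r] or [+oo] on the left is
   contradicted by [b = r - 1] or [b = 1]. *)
- case: (tau_dual_at A theta) taule => [r| |] taule //.
    have lt12 : r - 2 < r - 1 by lra.
    have := taule _ _ (ltNyr _) lt12.
    by rewrite lee_fin lerBrDr gerDl ler10.
  by have := taule _ _ (ltNyr _) (@ltr01 R).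
apply/lee_addgt0Pr => e e0; rewrite -EFinD; apply: (taule (r + e / 2)).
  by rewrite lte_fin ltrDl divr_gt0.
by rewrite ltrD2l ltr_pdivrMr// ltr_pMr// ltr1n.
Qed.

End scaled_basis.

Theorem lemma4p10 (R : realType) (p : \bar R) (p1 : (1 <= p)%E)
    (alpha : nat -> R) (alpha_gt0 : forall n, 0 < alpha n)
    (alpha_decr : forall n, alpha n.+1 <= alpha n)
    (alpha_cvg0 : alpha @ \oo --> (0 : R)) :
  let A : set (ell p1) := [set alpha n *: ell_e p1 n | n in [set: nat]] in
  (tau_dual A <= box_dim A)%E.
Proof.
(* The bound does not depend on [theta], so it passes to the limit. *)
cbv zeta; apply: lime_le; first exact: is_cvg_tau_dual.
apply: filterS (nbhs_right_gt (0 : R)) => theta; exact: tau_dual_at_le_box_dim.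
Qed.
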